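(* Let $C\subset\mathbb{R}^m$ be closed, let $F\colon\mathbb{R}^n\to\mathbb{R}^m$ be twice continuously differentiable, and let $\bar x\in S:=F^{-1}(C)=\{x\in\mathbb{R}^n\mid F(x)\in C\}$. Then for each $x^*\in\mathbb{R}^n$ and $u\in\mathbb{R}^n$, $$\mathrm{d}^2\delta_S(\bar x;x^* )(u)\ \ge\ \sup_{y^*\in\mathbb{R}^m,\ \nabla F(\bar x)^\top y^*=x^*}\Bigl(\langle y^*,\nabla^2F(\bar x)(u,u)\rangle+\mathrm{d}^2\delta_C(F(\bar x);y^* )(\nabla F(\bar x)u)\Bigr).$$ If $\nabla F(\bar x)$ possesses full row rank, then for each $y^*\in\mathbb{R}^m$ and $u\in\mathbb{R}^n$, $$\mathrm{d}^2\delta_S(\bar x;\nabla F(\bar x)^\top y^* )(u)=\langle y^*,\nabla^2F(\bar x)(u,u)\rangle+\mathrm{d}^2\delta_C(F(\bar x);y^* )(\nabla F(\bar x)u).$$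
   Context: $\delta_S$ denotes the indicator function of $S$ ($0$ on $S$, $+\infty$ off $S$). For $h\colon\mathbb{R}^n\to\mathbb{R}\cup\{-\infty,\infty\}$ lower semicontinuous, $|h(\bar z)|<\infty$ and $z^*\in\mathbb{R}^n$, the second subderivative is $$\mathrm{d}^2h(\bar z;z^* )(w):=\liminf_{t\downarrow0,\,w'\to w}\frac{h(\bar z+tw')-h(\bar z)-t\langle z^*,w'\rangle}{\frac12t^2}\in[-\infty,\infty].$$ $\nabla F(\bar x)$ is the Jacobian, and $\langle y^*,\nabla^2F(\bar x)(u,u)\rangle:=\sum_{i=1}^my_i^*\,u^\top\nabla^2F_i(\bar x)u$. The supremum over the empty set is $-\infty$. *)

(* Defs.v *)
From HB Require Import structures.
From mathcomp Require Import all_boot all_order all_algebra.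
From mathcomp Require Import all_classical all_reals all_analysis.

Set Implicit Arguments.
Unset Strict Implicit.
Unset Printing Implicit Defensive.

Import Order.TTheory GRing.Theory Num.Theory.
Import numFieldNormedType.Exports.

Local Open Scope classical_set_scope.
Local Open Scope ring_scope.

(* Vectors of R^n are row vectors, as in the library's ['J F x], which is the
   n x m matrix with [v *m 'J F x = 'd F x v]. *)

Definition dotp (R : realType) (n : nat) (a b : 'rV[R]_n) : R :=
  \sum_(i < n) a 0 i * b 0 i.

(* The usual m x n Jacobian: with row vectors, (nabla F x)^T y is
   [y *m nabla F x] and (nabla F x) u is [u *m (nabla F x)^T]. *)
Definition nabla (R : realType) (n m : nat) (F : 'rV[R]_n -> 'rV[R]_m)
    (x : 'rV[R]_n) : 'M[R]_(m, n) :=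
  ('J F x)^T.

Definition hessian (R : realType) (n : nat) (f : 'rV[R]_n -> R)
    (x : 'rV[R]_n) : 'M[R]_n :=
  \matrix_(i, j) 'D_(delta_mx 0 i) ('D_(delta_mx 0 j) f) x.

Definition twice_continuously_differentiable (R : realType) (n m : nat)
    (F : 'rV[R]_n -> 'rV[R]_m) : Prop :=
  [/\ forall x, differentiable F x,
      forall x, differentiable (nabla F) x
    & forall i : 'I_m, continuous (hessian (fun z => F z 0 i))].

Definition hessian_form (R : realType) (n m : nat)
    (F : 'rV[R]_n -> 'rV[R]_m) (x : 'rV[R]_n) (y : 'rV[R]_m)
    (u : 'rV[R]_n) : R :=
  \sum_(i < m) y 0 i * (u *m hessian (fun z => F z 0 i) x *m u^T) 0 0.

Local Open Scope ereal_scope.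

Definition indicator (R : realType) (n : nat) (S : set 'rV[R]_n)
    (x : 'rV[R]_n) : \bar R :=
  if x \in S then 0 else +oo.

(* Meaningful when [h z] is finite, so that the numerator is never oo - oo.
   The lower limit is along the product of the filters t -> 0+ and w' -> w. *)
Definition second_subderivative (R : realType) (n : nat)
    (h : 'rV[R]_n -> \bar R) (z zs w : 'rV[R]_n) : \bar R :=
  limf_einf
    (fun p : R * 'rV[R]_n =>
       (h (z + p.1 *: p.2)%R - h z - (p.1 * dotp zs p.2)%:E)
         / (2^-1 * p.1 ^+ 2)%:E)
    (filter_prod (0%R : R)^'+ (nbhs w)).

(* Main.v *)
Require Import Defs.
From HB Require Import structures.
From mathcomp Require Import all_boot all_order all_algebra.
From mathcomp Require Import all_classical all_reals all_analysis.
From mathcomp Require Import ring.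

Import Order.TTheory GRing.Theory Num.Theory.
Import numFieldNormedType.Exports.

Local Open Scope classical_set_scope.
Local Open Scope ring_scope.

(** Fix [x] with [F x \in C], let [N] be the Jacobian of [F] at [x], and for
    [t > 0] put [v(t, w) := (F (x + t w) - F x) / t], the difference quotient.
    Since [F (x + t w) = F x + t v(t, w)], the point [x + t w] lies in the
    preimage [S] of [C] exactly when [F x + t v(t, w)] lies in [C]. So the
    difference quotient that defines the second subderivative of the indicator
    of [S] at [(t, w)], for the multiplier [N^T y], is that of the indicator of
    [C] at [(t, v(t, w))], for the multiplier [y], plus the real number
    [k(t, w) := <y, F (x + t w) - F x - t N w> / (t^2 / 2)]: this is
    [second_difference_chain]. As [t] decreases to [0] and [w] tends to [u],

    - [k(t, w)] tends to the Hessian form of [<y, F>] at [u], by the second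
      order Taylor formula ([curvature_quotient_cvg]);
    - [v(t, w)] tends to [N u] ([difference_quotient_cvg]).

    Taking lower limits gives the inequality, because the values [v(t, w)] are
    only some of the directions that approach [N u].

    When [N] has full row rank they are all of them: every [v] close to [N u]
    is [v(t, w)] for some [w] close to [u], uniformly for small [t]
    ([difference_quotient_open]). With a right inverse of [N] the equation for
    [w] becomes a fixed point problem in [R^m], which is a contraction because
    [F] is strictly differentiable at [x]. The two lower limits then run over
    the same values and the inequality is an equality.

    Both comparisons of lower limits are instances of
    [limf_einf_transfer]. *)

(** * Norms of matrices *)

Lemma mx_norm_entry {R : realType} {m n : nat} (A : 'M[R]_(m, n)) i j : `|A i j| <= `|A|.
Proof.
rewrite [leRHS]/Num.norm /= mx_normrE.
exact: (le_bigmax _ (fun ij : 'I_m * 'I_n => `|A ij.1 ij.2|) (i, j)).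
Qed.

Lemma mx_norm_le {R : realType} {m n : nat} (A : 'M[R]_(m, n)) (c : R) :
  0 <= c -> (forall i j, `|A i j| <= c) -> `|A| <= c.
Proof.
by move=> c0 Ac; rewrite [leLHS]/Num.norm /= mx_normrE; apply: bigmax_le => //= -[].
Qed.

Lemma mx_norm_mul {R : realType} {m n p : nat} (A : 'M[R]_(m, n)) (B : 'M[R]_(n, p)) :
  `|A *m B| <= n%:R * `|A| * `|B|.
Proof.
apply: mx_norm_le => [|i j]; first by rewrite !mulr_ge0.
rewrite mxE (le_trans (ler_norm_sum _ _ _))//.
rewrite (@le_trans _ _ (\sum_(k < n) `|A| * `|B|))//; last first.
  by rewrite sumr_const card_ord -mulrA mulr_natl.
by apply: ler_sum => k _; rewrite normrM ler_pM// mx_norm_entry.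
Qed.

Lemma mx_norm_tr {R : realType} {m n : nat} (A : 'M[R]_(m, n)) : `|A^T| = `|A|.
Proof.
apply/eqP; rewrite eq_le; apply/andP; split; apply: mx_norm_le => // i j.
  by rewrite mxE mx_norm_entry.
by have := mx_norm_entry A^T j i; rewrite mxE.
Qed.

(** * Comparing lower limits *)

Section lower_limits.
Local Open Scope ereal_scope.

(** The points [q] are related to [p] by mere existence, not by a map, so that
    the lemma serves in both directions: with [q] the image of [p], and with
    [q] some preimage of [p]. *)
Lemma limf_einf_transfer {R : realType} {S T : choiceType}
    {X : filteredType S} {Y : filteredType T} (f : X -> \bar R) (g : Y -> \bar R)
    (F : set_system X) (G : set_system Y) (H : R) :
  (forall V (e : R), G V -> (0 < e)%R ->
     exists2 U, F U & forall p, U p -> exists2 q, V q & (H - e)%:E + g q <= f p) ->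
  H%:E + limf_einf g G <= limf_einf f F.
Proof.
move=> tr; rewrite !limf_einfE addeC -leeBrDr//.
apply: ge_ereal_sup => _ [V GV <-]; rewrite leeBrDr// addeC.
apply/lee_addgt0Pr => e e0.
have [U FU UV] := tr V e GV e0.
rewrite -leeBlDr// addeAC -EFinB.
apply: (@le_trans _ _ (ereal_inf (f @` U))); last first.
  by apply: ereal_sup_ubound; exists U.
apply: le_ereal_inf_tmp => _ [p Up <-].
have [q Vq qp] := UV p Up.
apply: le_trans qp; rewrite leeD2l//.
by apply: ereal_inf_lbound; exists q.
Qed.

End lower_limits.

(** * Mean value and Taylor estimates *)

Section differentiation.
Context {R : realType} {n m : nat} (F : 'rV[R]_n -> 'rV[R]_m).
Hypothesis dF : forall x, differentiable F x.

Lemma nabla_derive (i : 'I_m) (x v : 'rV[R]_n) :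
  'D_v (fun z => F z 0 i) x = (v *m (nabla F x)^T) 0 i.
Proof.
rewrite /nabla trmxK -deriveEjacobian// derive_mx//; last exact: diff_derivable.
by rewrite mxE.
Qed.

Lemma is_derive_line (i : 'I_m) (x h : 'rV[R]_n) (s : R) :
  is_derive s 1 (fun r : R => F (x + r *: h) 0 i) ((h *m (nabla F (x + s *: h))^T) 0 i).
Proof.
have dFi : derivable (fun z => F z 0 i) (x + s *: h) h.
  have /derivable_mxP dFh : derivable F (x + s *: h) h by exact: diff_derivable.
  exact: (dFh 0 i).
have E : (fun t : R => t^-1 *: (F (x + (t *: 1 + s) *: h) 0 i - F (x + s *: h) 0 i))
    = (fun t : R => t^-1 *: (F (t *: h + (x + s *: h)) 0 i - F (x + s *: h) 0 i)).
  by apply/funext => t; rewrite scalerDl addrCA -[t *: 1]/(t * 1) mulr1.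
by apply: DeriveDef; rewrite -?nabla_derive /derivable /derive E.
Qed.

(** The mean value theorem on [[0, 1]] for
    [r |-> F_i (x + r h) - r c - r^2 d / 2]. Subtracting the candidate Taylor
    polynomial along the segment before taking the derivative yields a second
    order remainder from a single derivative of the Jacobian. *)
Lemma coord_mean_value (i : 'I_m) (x h : 'rV[R]_n) (c d : R) :
  exists2 s, s \in `[0, 1] &
    F (x + h) 0 i - F x 0 i - c - d / 2
    = (h *m (nabla F (x + s *: h))^T) 0 i - c - s * d.
Proof.
pose rho : R -> R := (fun r : R => F (x + r *: h) 0 i) - c *: (id : R -> R)
  - (d / 2) *: ((id : R -> R) ^+ 2).
have drho (s : R) : is_derive s 1 rho ((h *m (nabla F (x + s *: h))^T) 0 i - c - s * d).
  have dl := is_derive_line i x h s.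
  apply: is_derive_eq.
  rewrite /GRing.scale/= expr1.
by field.
have [|s s01 Es] := @MVT_segment R rho _ 0 1 ler01 (fun s _ => drho s).
  apply: derivable_within_continuous => r _; exact: ex_derive.
exists s => //; move: Es; rewrite subr0 mulr1 => <-.
rewrite /rho !fctE /= scale1r scale0r addr0 /GRing.scale /=.
by field.
Qed.
End differentiation.

Lemma mulmx_combination {R : realType} {n m : nat} (h : 'rV[R]_n)
    (A B D : 'M[R]_(m, n)) (s : R) i :
  (h *m A^T) 0 i - (h *m B^T) 0 i - s * (h *m D^T) 0 i
  = (h *m (A - B - s *: D)^T) 0 i.
Proof.
rewrite !mxE mulr_sumr -!sumrB; apply: eq_bigr => k _; rewrite !mxE.
by ring.
Qed.

Lemma diff_estimate {R : realType} {V W : normedModType R} (f : V -> W) (x : V) (e : R) :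
  differentiable f x -> 0 < e ->
  exists2 d, 0 < d & forall h, `|h| < d -> `|f (x + h) - f x - 'd f x h| <= e * `|h|.
Proof.
move=> /diff_locallyP[_ /eqaddoP/[apply]] /nbhs_normP[d /= d0 dE].
exists d => // h hd; have := dE h; rewrite /= sub0r normrN => /(_ hd).
by rewrite !fctE/= opprD addrA [h + x]addrC.
Qed.


Section taylor.
Context {R : realType} {n m : nat} (F : 'rV[R]_n -> 'rV[R]_m) (x : 'rV[R]_n).
Hypothesis dF : forall x, differentiable F x.
Hypothesis dN : differentiable (nabla F) x.

(** The entries of the Hessian are directional derivatives of the Jacobian, so
    its quadratic form is read off the differential of the Jacobian. *)
Lemma hessian_quadratic (i : 'I_m) (h : 'rV[R]_n) :
  (h *m hessian (fun z => F z 0 i) x *m h^T) 0 0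
  = (h *m ('d (nabla F) x h)^T) 0 i.
Proof.
have dNk k j : 'D_(delta_mx 0 k) ('D_(delta_mx 0 j) (fun z => F z 0 i)) x
    = ('d (nabla F) x (delta_mx 0 k)) i j.
  have -> : 'D_(delta_mx 0 j) (fun z => F z 0 i) = (fun z => nabla F z i j).
    apply/funext => z; rewrite nabla_derive//.
    by rewrite -rowE !mxE.
  rewrite -deriveE// derive_mx; last exact: diff_derivable.
  by rewrite mxE.
rewrite !mxE; apply: eq_bigr => j _; rewrite !mxE mulrC; congr (_ * _).
rewrite [in RHS](row_sum_delta h) linear_sum summxE.
by apply: eq_bigr => k _; rewrite linearZ !mxE dNk.
Qed.

(** With [c] and [d] the first and second order terms, the mean value is the
    matrix [nabla F (x + s h) - nabla F x - 'd (nabla F) x (s h)] applied to [h].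
    That matrix is [o(|h|)] by differentiability of the Jacobian at [x]. *)
Lemma taylor2 (e : R) : 0 < e ->
  exists2 d, 0 < d & forall (h : 'rV[R]_n) (i : 'I_m), `|h| < d ->
   `|F (x + h) 0 i - F x 0 i - (h *m (nabla F x)^T) 0 i
      - (h *m hessian (fun z => F z 0 i) x *m h^T) 0 0 / 2| <= e * `|h| ^+ 2.
Proof.
move=> e0.
(* The product of matrices costs a factor n; n.+1 keeps e' meaningful at n = 0. *)
pose e' := e / n.+1%:R.
have e'0 : 0 < e' by rewrite divr_gt0.
have [d d0 dE] := diff_estimate _ _ _ dN e'0.
exists d => // h i hd.
have [s /[!in_itv]/= /andP[s0 s1] ->] := coord_mean_value F dF i x h
  ((h *m (nabla F x)^T) 0 i) ((h *m hessian (fun z => F z 0 i) x *m h^T) 0 0).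
have sh : `|s *: h| <= `|h| by rewrite normrZ ger0_norm// ler_piMl.
have -> : (h *m (nabla F (x + s *: h))^T) 0 i - (h *m (nabla F x)^T) 0 i
    - s * (h *m hessian (fun z => F z 0 i) x *m h^T) 0 0
  = (h *m (nabla F (x + s *: h) - nabla F x - 'd (nabla F) x (s *: h))^T) 0 i.
  have -> : 'd (nabla F) x (s *: h) = s *: 'd (nabla F) x h by exact: linearZ.
  by rewrite hessian_quadratic mulmx_combination.
apply: le_trans (mx_norm_entry _ _ _) _.
apply: le_trans (mx_norm_mul _ _) _.
rewrite mx_norm_tr.
have dEh := dE _ (le_lt_trans sh hd).
apply: (@le_trans _ _ (n%:R * `|h| * (e' * `|h|))).
  by rewrite ler_wpM2l ?mulr_ge0// (le_trans dEh)// ler_wpM2l// ltW.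
rewrite expr2 mulrACA mulrA -mulrA ler_wpM2r ?mulr_ge0// /e' mulrCA ler_piMr ?ltW//.
by rewrite ltr_pdivrMr// mul1r ltr_nat.
Qed.

(** Here the mean value theorem is used on the segment from [b] to [a], on which
    the Jacobian is close to its value at [x] by continuity. *)
Lemma strict_differentiability (e : R) : 0 < e ->
  exists2 d, 0 < d & forall a b : 'rV[R]_n, `|a - x| < d -> `|b - x| < d ->
   `|F a - F b - (a - b) *m (nabla F x)^T| <= e * `|a - b|.
Proof.
move=> e0.
(* The product of matrices costs a factor n; n.+1 keeps e' meaningful at n = 0. *)
pose e' := e / n.+1%:R.
have e'0 : 0 < e' by rewrite divr_gt0.
have /cvgrPdist_le/(_ e' e'0)/nbhs_normP[d /= d0 dE] := differentiable_continuous dN.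
exists d => // a b ad bd; apply: mx_norm_le => [|k i].
  by rewrite mulr_ge0// ltW.
rewrite ord1 => {k}.
have [s /[!in_itv]/= /andP[s0 s1] E] := coord_mean_value F dF i b (a - b)
  (((a - b) *m (nabla F x)^T) 0 i) 0.
move: E; rewrite mul0r mulr0 !subr0 [b + (a - b)]addrC subrK => E.
have sd : `|x - (b + s *: (a - b))| < d.
  have -> : x - (b + s *: (a - b)) = s *: (x - a) + (1 - s) *: (x - b).
    by apply/rowP => j; rewrite !mxE; ring.
  apply: le_lt_trans (ler_normD _ _) _; rewrite !normrZ.
  rewrite !ger0_norm// ?subr_ge0// ![`|x - _|]distrC.
  have [->|s_neq0] := eqVneq s 0; first by rewrite mul0r add0r subr0 mul1r.
  have sp : 0 < s by rewrite lt_neqAle eq_sym s_neq0.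
  have -> : d = s * d + (1 - s) * d by ring.
  by rewrite ltr_leD// ?ltr_pM2l// ler_wpM2l ?subr_ge0// ltW.
have -> : (F a - F b - (a - b) *m (nabla F x)^T) 0 i
   = ((a - b) *m (nabla F (b + s *: (a - b)) - nabla F x)^T) 0 i.
  have entryB (A B C : 'rV[R]_m) : (A - B - C) 0 i = A 0 i - B 0 i - C 0 i.
    by rewrite !mxE.
  have := mulmx_combination (a - b) (nabla F (b + s *: (a - b))) (nabla F x) 0 0 i.
  by rewrite entryB E mul0r scale0r !subr0.
apply: le_trans (mx_norm_entry _ _ _) _.
apply: le_trans (mx_norm_mul _ _) _.
rewrite mx_norm_tr [X in _ * X <= _]distrC.
apply: (@le_trans _ _ (n%:R * `|a - b| * e')).
  by rewrite ler_wpM2l ?mulr_ge0// dE.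
rewrite mulrAC ler_wpM2r// /e' mulrCA ler_piMr ?ltW//.
by rewrite ltr_pdivrMr// mul1r ltr_nat.
Qed.
End taylor.

(** * Directions and small steps *)

(** One radius serves for both factors, so that finitely many conditions are
    combined by a minimum. *)
Lemma near_right_prodP {R : realType} {n : nat} (u : 'rV[R]_n) (V : set (R * 'rV[R]_n)) :
  filter_prod (0%R : R)^'+ (nbhs u) V <->
  exists2 d, 0 < d & forall t w, 0 < t < d -> `|w - u| < d -> V (t, w).
Proof.
split=> [[[P Q] /= [P0 Qu] PQV]|[d d0 dV]].
  have /nbhs_normP[a /= a0 aP] := P0; have /nbhs_normP[b /= b0 bQ] := Qu.
  exists (Num.min a b); first by rewrite lt_min a0.
  move=> t w /andP[t0]; rewrite !lt_min => /andP[ta tb] /andP[wa wb].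
  apply: PQV; split => /=.
    by apply: aP => //=; rewrite sub0r normrN gtr0_norm.
  by apply: bQ; rewrite /= distrC.
exists ([set t | 0 < t < d], [set w | `|w - u| < d]) => /=; last first.
  by move=> [t w] [/= td wd]; exact: dV.
split.
  apply: (nbhs_normP (0 : R) _).2; exists d => //= t /=; rewrite sub0r normrN => td t0.
  by rewrite t0 (le_lt_trans (ler_norm t)).
by apply: (nbhs_normP u _).2; exists d => //= w /=; rewrite distrC.
Qed.

Lemma cvg_sum_ord {R : realType} {T : Type} (F : set_system T) {FF : Filter F}
    (k : nat) (f : 'I_k -> T -> R) (l : 'I_k -> R) :
  (forall i, f i @ F --> l i) -> (fun z => \sum_i f i z) @ F --> \sum_i l i.
Proof.
move=> fl; have -> : (fun z => \sum_i f i z) = \sum_i f i.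
  by apply/funext => z; rewrite fct_sumE.
apply: (big_ind2 (fun (g : T -> R) (b : R) => g @ F --> b)) => //.
- exact: cvg_cst.
- by move=> g1 b1 g2 b2 h1 h2; exact: cvgD.
Qed.

Lemma hessian_form_continuous {R : realType} {n m : nat} (F : 'rV[R]_n -> 'rV[R]_m) x y :
  continuous (hessian_form F x y).
Proof.
move=> u; rewrite /continuous_at /hessian_form.
apply: (@cvg_sum_ord R _ (nbhs u)) => i; apply: cvgMr.
have -> : (fun w : 'rV[R]_n => (w *m hessian (fun z => F z 0 i) x *m w^T) 0 0)
   = (fun w : 'rV[R]_n => \sum_j
        (\sum_k w 0 k * hessian (fun z => F z 0 i) x k j) * w 0 j).
  apply/funext => w; rewrite mxE; apply: eq_bigr => j _; rewrite [w^T _ _]mxE.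
  by rewrite [X in X * _]mxE.
have -> : (u *m hessian (fun z => F z 0 i) x *m u^T) 0 0
   = \sum_j (\sum_k u 0 k * hessian (fun z => F z 0 i) x k j) * u 0 j.
  rewrite mxE; apply: eq_bigr => j _; rewrite [u^T _ _]mxE.
  by rewrite [X in X * _]mxE.
apply: (@cvg_sum_ord R _ (nbhs u)) => j; apply: cvgM; last exact: coord_continuous.
by apply: (@cvg_sum_ord R _ (nbhs u)) => k; apply: cvgMl; exact: coord_continuous.
Qed.

(** * Difference quotients at a point *)

(** The fixed point theorem needs a space that is complete and normed at once. *)
HB.instance Definition _ (R : realType) n := Complete.on 'rV[R]_n.

Definition difference_quotient {R : realType} {n m : nat} (F : 'rV[R]_n -> 'rV[R]_m)
    (x : 'rV[R]_n) (t : R) (w : 'rV[R]_n) : 'rV[R]_m :=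
  t^-1 *: (F (x + t *: w) - F x).

(** The curvature of [F] in the direction [y], measured at step [t]. *)
Definition curvature_quotient {R : realType} {n m : nat} (F : 'rV[R]_n -> 'rV[R]_m)
    (x : 'rV[R]_n) (y : 'rV[R]_m) (t : R) (w : 'rV[R]_n) : R :=
  dotp y (F (x + t *: w) - F x - t *: w *m (nabla F x)^T) / (2^-1 * t ^+ 2).

Lemma dotp_trmx {R : realType} {n m : nat} (y : 'rV[R]_m) (N : 'M[R]_(m, n)) w :
  dotp (y *m N) w = dotp y (w *m N^T).
Proof.
have dE k (a b : 'rV[R]_k) : dotp a b = (a *m b^T) 0 0.
  by rewrite mxE; apply: eq_bigr => i _; rewrite mxE.
by rewrite !dE trmx_mul trmxK mulmxA.
Qed.

Lemma dotpB {R : realType} {k : nat} (y a b : 'rV[R]_k) :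
  dotp y (a - b) = dotp y a - dotp y b.
Proof.
by rewrite /dotp -sumrB; apply: eq_bigr => i _; rewrite !mxE mulrBr.
Qed.

Lemma dotpZ {R : realType} {k : nat} (y a : 'rV[R]_k) s : dotp y (s *: a) = s * dotp y a.
Proof.
by rewrite /dotp mulr_sumr; apply: eq_bigr => i _; rewrite mxE mulrCA.
Qed.

Section base_point.
Context {R : realType} {n m : nat} (F : 'rV[R]_n -> 'rV[R]_m) (x : 'rV[R]_n).
Hypothesis dF : forall x, differentiable F x.
Hypothesis dN : differentiable (nabla F) x.

Lemma difference_quotientK (t : R) w :
  t != 0 -> F x + t *: difference_quotient F x t w = F (x + t *: w).
Proof. by move=> t0; rewrite scalerA divff// scale1r addrC subrK. Qed.

(** By [taylor2] at [t w], the quotient differs from the Hessian form at [w] by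
    at most a multiple of [|w|^2], with a small factor; the Hessian form is then
    moved from [w] to [u] by continuity. *)
Lemma curvature_quotient_cvg (y : 'rV[R]_m) (u : 'rV[R]_n) (e : R) : 0 < e ->
  exists2 d, 0 < d & forall t w, 0 < t < d -> `|w - u| < d ->
    `|curvature_quotient F x y t w - hessian_form F x y u| <= e.
Proof.
move=> e0.
have e20 : 0 < e / 2 by rewrite divr_gt0.
have /cvgrPdist_le/(_ _ e20)/nbhs_normP[d1 /= d10 hd1] := hessian_form_continuous F x y u.
pose c := (\sum_i `|y 0 i|) * (2 * (`|u| + 1) ^+ 2) + 1.
have c0 : 0 < c by rewrite ltr_wpDl// mulr_ge0// sumr_ge0.
have [d2 d20 hd2] := taylor2 F x dF dN (e / 2 / c) (divr_gt0 e20 c0).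
have u10 : 0 < `|u| + 1 by rewrite ltr_wpDl.
exists (Num.min d1 (Num.min 1 (d2 / (`|u| + 1)))).
  by rewrite !lt_min d10 ltr01 divr_gt0.
move=> t w /andP[t0]; rewrite !lt_min => /and3P[_ _ td2] /and3P[wd1 w1 _].
have wu : `|w| <= `|u| + 1.
  by rewrite -[w](subrK u) addrC (le_trans (ler_normD _ _))// lerD2l ltW.
have tw : `|t *: w| < d2.
  rewrite normrZ gtr0_norm// (le_lt_trans _ (_ : t * (`|u| + 1) < d2))//.
    by rewrite ler_wpM2l// ltW.
  by rewrite -ltr_pdivlMr.
rewrite (le_trans (ler_distD (hessian_form F x y w) _ _))// [leRHS](splitr e).
rewrite lerD//; last first.
  by rewrite distrC hd1//= distrC.
have t2 : 0 < 2^-1 * t ^+ 2 by rewrite mulr_gt0// exprn_gt0.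
have -> : curvature_quotient F x y t w - hessian_form F x y w =
   (\sum_i y 0 i * (F (x + t *: w) 0 i - F x 0 i - (t *: w *m (nabla F x)^T) 0 i
      - (t *: w *m hessian (fun z => F z 0 i) x *m (t *: w)^T) 0 0 / 2))
   / (2^-1 * t ^+ 2).
  apply: (canRL (mulfK (lt0r_neq0 t2))).
  rewrite mulrBl divfK ?lt0r_neq0// /dotp /hessian_form mulr_suml -sumrB.
  apply: eq_bigr => i _; rewrite mulrBr; congr (_ - _); first by rewrite !mxE.
  rewrite -!scalemxAl linearZ/= -scalemxAr; set q := _ *m _ *m _.
  by rewrite !mxE; field.
rewrite normrM [`|_^-1|]gtr0_norm ?invr_gt0// ler_pdivrMr//.
apply: le_trans (ler_norm_sum _ _ _) _.
have ec0 : 0 <= e / 2 / c by rewrite divr_ge0// ltW.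
have tu0 : 0 <= t * (`|u| + 1) by rewrite mulr_ge0// ltW.
apply: (@le_trans _ _ (\sum_i `|y 0 i| * (e / 2 / c * (t * (`|u| + 1)) ^+ 2))).
  apply: ler_sum => i _; rewrite normrM ler_wpM2l// (le_trans (hd2 _ i tw))//.
  rewrite ler_wpM2l// lerXn2r ?nnegrE//.
  by rewrite normrZ gtr0_norm// ler_wpM2l// ltW.
rewrite -mulr_suml.
have -> : (\sum_i `|y 0 i|) * (e / 2 / c * (t * (`|u| + 1)) ^+ 2) =
   e / 2 * (2^-1 * t ^+ 2) * ((c - 1) / c).
  by rewrite /c addrK; field; rewrite -/c lt0r_neq0.
rewrite ler_piMr ?mulr_ge0 ?ltW// ?ltr_pdivrMr// mul1r.
by rewrite ltrBlDr ltrDl.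
Qed.

(** Strict differentiability, rescaled by [t]: on a bounded set of directions
    the difference quotient is, for all small [t] at once, a small Lipschitz
    perturbation of the derivative. *)
Lemma difference_quotient_lipschitz (K e : R) : 0 < e ->
  exists2 d, 0 < d & forall t w w', 0 < t < d -> `|w| <= K -> `|w'| <= K ->
    `|difference_quotient F x t w - difference_quotient F x t w'
       - (w - w') *m (nabla F x)^T| <= e * `|w - w'|.
Proof.
move=> e0; have [d d0 hd] := strict_differentiability F x dF dN e e0.
have K1 : 0 < `|K| + 1 by rewrite ltr_wpDl.
exists (d / (`|K| + 1)); first by rewrite divr_gt0.
move=> t w w' /andP[t0 td] wK w'K.
have near_x v : `|v| <= K -> `|x + t *: v - x| < d.
  move=> vK; rewrite addrC addKr normrZ gtr0_norm//.
  rewrite ltr_pdivlMr// in td; apply: le_lt_trans td; rewrite ler_wpM2l//.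
    exact: ltW.
  by rewrite (le_trans vK)// (le_trans (ler_norm K))// lerDl.
have := hd _ _ (near_x w wK) (near_x w' w'K).
have -> : x + t *: w - (x + t *: w') = t *: (w - w').
  by rewrite opprD addrACA subrr add0r -scalerBr.
rewrite normrZ gtr0_norm// mulrCA -scalemxAl -ler_pdivrMl// => le_e.
apply: le_trans le_e; rewrite -[X in X * _]gtr0_norm ?invr_gt0// -normrZ.
rewrite scalerBr [t^-1 *: (t *: _)]scalerA mulVf ?gt_eqF// scale1r.
by rewrite /difference_quotient -scalerBr opprB addrA subrK.
Qed.

Lemma difference_quotient0 t : difference_quotient F x t 0 = 0.
Proof. by rewrite /difference_quotient scaler0 addr0 subrr scaler0. Qed.

Lemma difference_quotient_cvg (u : 'rV[R]_n) (e : R) : 0 < e ->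
  exists2 d, 0 < d & forall t w, 0 < t < d -> `|w - u| < d ->
    `|difference_quotient F x t w - u *m (nabla F x)^T| < e.
Proof.
move=> e0; pose N := (nabla F x)^T.
have u1 : 0 < `|u| + 1 by rewrite ltr_wpDl.
pose e1 := e / 2 / (`|u| + 1).
have e10 : 0 < e1 by rewrite !divr_gt0.
have [d1 d10 hd1] := difference_quotient_lipschitz (`|u| + 1) e1 e10.
pose c := n%:R * `|N| + 1.
have c0 : 0 < c by rewrite ltr_wpDl// mulr_ge0.
exists (Num.min d1 (Num.min 1 (e / 2 / c))).
  by rewrite !lt_min d10 ltr01 !divr_gt0.
move=> t w /andP[t0]; rewrite !lt_min => /and3P[td1 _ _] /and3P[_ w1 wc].
have wu : `|w| <= `|u| + 1.
  by rewrite -[w](subrK u) addrC (le_trans (ler_normD _ _))// lerD2l ltW.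
have := hd1 t w 0 _ wu.
rewrite t0 td1 normr0 difference_quotient0 !subr0 => /(_ isT (ltW u1)).
have e1w : e1 * `|w| <= e / 2.
  by rewrite /e1 mulrAC ler_pdivrMr// ler_wpM2l// ltW// divr_gt0.
move=> /le_trans/(_ e1w) h1.
have -> : difference_quotient F x t w - u *m N =
   (difference_quotient F x t w - w *m N) + (w - u) *m N.
  by rewrite mulmxBl addrA subrK.
rewrite (le_lt_trans (ler_normD _ _))// (splitr e) ler_ltD//.
apply: le_lt_trans (mx_norm_mul _ _) _.
move: wc; rewrite ltr_pdivlMr//; apply: le_lt_trans.
by rewrite mulrAC mulrC ler_wpM2l// lerDl.
Qed.

(** The perturbed map [w |-> difference_quotient F x t w] inherits surjectivity
    near [u] from its limit. With [B] a right inverse of the derivative, the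
    directions are restricted to [u + z B], and a solution is a fixed point of
    [z |-> z - (difference_quotient F x t (u + z B) - v)]; this map has Lipschitz
    constant [1 / 2] on the ball of radius [r] and moves [0] by at most [r / 2],
    hence maps that ball to itself. *)
Lemma difference_quotient_open (u : 'rV[R]_n) (e : R) :
  row_free (nabla F x) -> 0 < e ->
  exists2 d, 0 < d & forall t v, 0 < t < d -> `|v - u *m (nabla F x)^T| < d ->
    exists2 w, `|w - u| < e & difference_quotient F x t w = v.
Proof.
move=> rfN e0; pose N := (nabla F x)^T; pose B := (pinvmx (nabla F x))^T.
have BN : B *m N = 1%:M by rewrite -trmx_mul mulmxVp// trmx1.
pose c := m%:R * `|B| + 1.
have c0 : 0 < c by rewrite ltr_wpDl// mulr_ge0.
have cB (z : 'rV[R]_m) : `|z *m B| <= c * `|z|.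
  rewrite (le_trans (mx_norm_mul _ _))// mulrAC ler_wpM2r//.
  by rewrite lerDl.
(* Then |z B| <= c r = e / 2 for |z| <= r. *)
pose r := e / 2 / c.
have r0 : 0 < r by rewrite !divr_gt0.
have e20 : 0 < 2^-1 / c by rewrite divr_gt0.
have [d1 d10 hd1] := difference_quotient_lipschitz (`|u| + c * r) (2^-1 / c) e20.
have r40 : 0 < r / 4 by rewrite divr_gt0.
have [d2 d20 hd2] := difference_quotient_cvg u (r / 4) r40.
exists (Num.min d1 (Num.min d2 (r / 4))).
  by rewrite !lt_min d10 d20.
move=> t v /andP[t0]; rewrite !lt_min => /and3P[td1 td2 _] /and3P[_ _ vr].
pose T (z : 'rV[R]_m) := z - (difference_quotient F x t (u + z *m B) - v).
pose U := [set z : 'rV[R]_m | `|z| <= r].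
have lipT z z' : U z -> U z' -> `|T z - T z'| <= 2^-1 * `|z - z'|.
  have in_ball s : U s -> `|u + s *m B| <= `|u| + c * r.
    move=> Us; rewrite (le_trans (ler_normD _ _))// lerD2l (le_trans (cB _))//.
    by rewrite ler_wpM2l// ltW.
  move=> Uz Uz'; have := hd1 t _ _ _ (in_ball _ Uz) (in_ball _ Uz').
  rewrite t0 td1 => /(_ isT).
  have -> : u + z *m B - (u + z' *m B) = (z - z') *m B.
    by rewrite opprD addrACA subrr add0r mulmxBl.
  rewrite -mulmxA BN mulmx1 -normrN => hT.
  have -> : T z - T z' = - (difference_quotient F x t (u + z *m B)
       - difference_quotient F x t (u + z' *m B) - (z - z')).
    by rewrite /T; apply/rowP => j; rewrite !mxE; ring.
  apply: le_trans hT _; rewrite -mulrA ler_wpM2l// ler_pdivrMl//.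
have T0 : `|T 0| <= r / 2.
  have -> : T 0 = (v - u *m N) - (difference_quotient F x t u - u *m N).
    by rewrite /T mul0mx addr0; apply/rowP => j; rewrite !mxE; ring.
  rewrite (le_trans (ler_normB _ _))//.
  have -> : r / 2 = r / 4 + r / 4 by field.
  by rewrite lerD// ltW// hd2 ?t0// subrr normr0.
have U0 : U 0 by rewrite /U /= normr0 ltW.
have TU : set_fun U U T.
  move=> z Uz; rewrite /U /= -[T z](subrK (T 0)) (le_trans (ler_normD _ _))//.
  rewrite (splitr r) lerD// (le_trans (lipT _ _ Uz U0))// subr0.
  by rewrite [leRHS]mulrC ler_wpM2l.
have Tcontr : is_contraction (mkfun TU).
  exists 2^-1%:nng; split => /=; first by rewrite invf_lt1// ltr1n.
  by move=> [z z'] [/= Uz Uz']; exact: lipT.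
have clU : closed U.
  have -> : U = closed_ball_ Num.norm 0 r.
    by apply/seteqP; split => z; rewrite /U /closed_ball_ /= sub0r normrN.
  exact: closed_closed_ball_.
have [z Uz /= Tz] := banach_fixed_point Tcontr clU (ex_intro _ 0 U0).
exists (u + z *m B).
  rewrite addrC addKr (le_lt_trans (cB z))//.
  rewrite (@le_lt_trans _ _ (c * r))// ?ler_wpM2l//; first exact: ltW.
  by rewrite /r mulrC divfK ?gt_eqF// ltr_pdivrMr// ltr_pMr// ltr1n.
move: Tz => /eqP; rewrite /T -[X in X == _]subr0 (inj_eq (addrI z)) eqr_opp eq_sym.
by rewrite subr_eq0 => /eqP.
Qed.

End base_point.

(** * The chain rule for second subderivatives *)

Local Open Scope ereal_scope.

(** The family whose lower limit is the second subderivative of [h]. *)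
Definition second_difference {R : realType} {n : nat} (h : 'rV[R]_n -> \bar R)
    (z zs : 'rV[R]_n) (p : R * 'rV[R]_n) : \bar R :=
  (h (z + p.1 *: p.2)%R - h z - (p.1 * dotp zs p.2)%:E) / (2^-1 * p.1 ^+ 2)%:E.

(** Both sides are infinite together, since [x + t w] lies in the preimage exactly
    when [F x + t * difference_quotient F x t w = F (x + t w)] lies in [C]. When
    they are finite only the linear terms differ, by the curvature quotient. *)
Lemma second_difference_chain {R : realType} {n m : nat} (C : set 'rV[R]_m)
    (F : 'rV[R]_n -> 'rV[R]_m) (x : 'rV[R]_n) (y : 'rV[R]_m) (t : R) w :
  C (F x) -> (0 < t)%R ->
  second_difference (indicator (F @^-1` C)) x (y *m nabla F x)%R (t, w)
  = (curvature_quotient F x y t w)%:E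
    + second_difference (indicator C) (F x) y (t, difference_quotient F x t w).
Proof.
move=> CFx t0; rewrite /second_difference /=.
have tq : (0 < 2^-1 * t ^+ 2)%R by rewrite mulr_gt0// exprn_gt0.
rewrite difference_quotientK ?gt_eqF//.
have memS z : (z \in F @^-1` C) = (F z \in C).
  by apply/idP/idP; rewrite !inE.
rewrite /indicator !memS [F x \in C]mem_set//.
rewrite !sube0 inver gt_eqF//.
case: ifP => _; last first.
  by rewrite addye// gt0_mulye ?lte_fin ?invr_gt0// addey.
rewrite !add0e -!EFinM -EFinD; congr EFin.
rewrite /curvature_quotient /difference_quotient dotp_trmx.
rewrite -scalemxAl dotpB !dotpZ; field.
by rewrite gt_eqF.
Qed.

Theorem proposition4p9 (R : realType) (n m : nat)
    (C : set 'rV[R]_m) (F : 'rV[R]_n -> 'rV[R]_m) (x : 'rV[R]_n)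
    (hC : closed C) (hF : twice_continuously_differentiable F)
    (hx : (F @^-1` C) x) :
  (forall xs u : 'rV[R]_n,
     ereal_sup
       [set (hessian_form F x y u)%:E
            + second_subderivative (indicator C) (F x) y (u *m (nabla F x)^T)%R
       | y in [set y : 'rV[R]_m | (y *m nabla F x)%R = xs]]
     <= second_subderivative (indicator (F @^-1` C)) x xs u) /\
  (row_free (nabla F x) ->
   forall (y : 'rV[R]_m) (u : 'rV[R]_n),
     second_subderivative (indicator (F @^-1` C)) x (y *m nabla F x)%R u
     = (hessian_form F x y u)%:E
       + second_subderivative (indicator C) (F x) y (u *m (nabla F x)^T)%R).
Proof.
have [dF /(_ x) dN _] := hF.
have lower y u : (hessian_form F x y u)%:E
      + second_subderivative (indicator C) (F x) y (u *m (nabla F x)^T)%R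
    <= second_subderivative (indicator (F @^-1` C)) x (y *m nabla F x)%R u.
  apply: limf_einf_transfer => V e /near_right_prodP[d d0 dV] e0.
  have [d1 d10 hd1] := curvature_quotient_cvg F x dF dN y u e e0.
  have [d2 d20 hd2] := difference_quotient_cvg F x dF dN u d d0.
  exists [set p | (0 < p.1 < Num.min d (Num.min d1 d2)
      /\ `|p.2 - u| < Num.min d (Num.min d1 d2))%R].
    apply/near_right_prodP; exists (Num.min d (Num.min d1 d2)) => //.
    by rewrite !lt_min d0 d10.
  move=> [t w] [/= /andP[t0]]; rewrite !lt_min => /and3P[td td1 td2] /and3P[_ wd1 wd2].
  exists (t, difference_quotient F x t w).
    by apply: dV; rewrite ?t0// hd2// t0.
  have := second_difference_chain C F x y t w hx t0; rewrite /second_difference /= => ->.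
  rewrite leeD2r// lee_fin lerBlDr -lerBlDl.
  have := hd1 t w; rewrite t0 td1 => /(_ isT wd1).
  by rewrite distrC ler_norml => /andP[_].
split=> [xs u|rfN y u].
  by apply: ge_ereal_sup => _ [y /= <- <-]; exact: lower.
apply/eqP; rewrite eq_le lower andbT.
(* The reverse bound is the same comparison with the two sides exchanged: the
   Hessian form changes sign, and w is found by openness. *)
rewrite -leeBlDl// addeC -EFinN.
apply: limf_einf_transfer => V e /near_right_prodP[d d0 dV] e0.
have [d1 d10 hd1] := curvature_quotient_cvg F x dF dN y u e e0.
have r0 : (0 < Num.min d d1)%R by rewrite lt_min d0.
have [d2 d20 hd2] := difference_quotient_open F x dF dN u _ rfN r0.
exists [set p | (0 < p.1 < Num.min d2 (Num.min d d1)
    /\ `|p.2 - u *m (nabla F x)^T| < Num.min d2 (Num.min d d1))%R].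
  apply/near_right_prodP; exists (Num.min d2 (Num.min d d1)) => //.
  by rewrite !lt_min d20 d0.
move=> [t v] [/= /andP[t0]]; rewrite lt_min => /andP[td2 tdd1].
rewrite lt_min => /andP[vd2 _]; move: tdd1; rewrite lt_min => /andP[td td1].
have [|w + wv] := hd2 t v _ vd2; first by rewrite t0.
rewrite lt_min => /andP[wd wd1].
exists (t, w); first by apply: dV; rewrite ?t0.
have := second_difference_chain C F x y t w hx t0.
rewrite /second_difference /= wv => ->.
rewrite addeA -EFinD -[leRHS]add0e leeD2r// lee_fin.
have := hd1 t w; rewrite t0 td1 => /(_ isT wd1).
rewrite ler_norml => /andP[_]; rewrite lerBlDr => h.
by rewrite addrC -opprD subr_le0 addrC.
Qed.
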